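(* The singular locus $\mathrm{sing}(L_{2,4})$ is the union of $60$ three-dimensional linear subspaces of $\mathbb C^6$, of three types: Type I (32 subspaces, whose union is $L_{1,4}$): for each choice of $s_{13},s_{23},s_{14},s_{24},s_{34}\in\{1,-1\}$, the subspace defined by $l_{12}-s_{13}l_{13}+s_{23}l_{23}=0$, $l_{12}-s_{14}l_{14}+s_{24}l_{24}=0$, $s_{13}l_{13}-s_{14}l_{14}+s_{34}l_{34}=0$. Type II (24 subspaces): for each edge $\{a,b\}$ of $K_4$, with $\{c,e\}$ the other two vertices, and each choice of signs $\epsilon_1,\epsilon_2\in\{1,-1\}$, the subspace defined by $l_{ab}=0$, $l_{ac}=\epsilon_1 l_{bc}$, $l_{ae}=\epsilon_2 l_{be}$ (e.g., for $\{1,2\}$: $l_{12}=0$, $l_{13}=s_{23}l_{23}$, $l_{14}=s_{24}l_{24}$). Type III (4 subspaces): for each triangle $\{a,b,c\}$ of $K_4$, the subspace defined by $l_{ab}=l_{ac}=l_{bc}=0$.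
   Context: Coordinates of $\mathbb C^6$ are $l_{ij}$ indexed by the edges $\{i,j\}$ of $K_4$ (write $l_{ij}=l_{ji}$). $L_{2,4}\subset\mathbb C^6$ is the hypersurface defined by the vanishing of the determinant of the symmetric $3\times3$ matrix with diagonal entries $2l_{14}^2,2l_{24}^2,2l_{34}^2$ and off-diagonal entries $(1,2)$: $l_{14}^2+l_{24}^2-l_{12}^2$, $(1,3)$: $l_{14}^2+l_{34}^2-l_{13}^2$, $(2,3)$: $l_{24}^2+l_{34}^2-l_{23}^2$; equivalently, it is the set of $l$ whose coordinatewise square is a vector of squared distances $\sum_{k=1}^2({\bf p}_i^k-{\bf p}_j^k)^2$ of some complex configuration of 4 points in $\mathbb C^2$. $L_{1,4}\subset\mathbb C^6$ is the analogous set for configurations of 4 points in $\mathbb C^1$. A point is singular if the dimension of the Zariski tangent space exceeds the local dimension. *)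

(* Defs.v *)
From HB Require Import structures.
From mathcomp Require Import all_boot all_order all_algebra.
From mathcomp Require Import mpoly.
From mathcomp Require Import complex.
From mathcomp Require Import reals.
Set Implicit Arguments. Unset Strict Implicit. Unset Printing Implicit Defensive.
Import Order.TTheory GRing.Theory Num.Theory.
Local Open Scope ring_scope.

(* Vertices 1,2,3,4 of K_4 are represented by 0,1,2,3 : 'I_4.
   Coordinates of C^6 are indexed by 'I_6 in the order
   l12, l13, l14, l23, l24, l34  (indices 0..5). *)
Definition eidx_nat (a b : nat) : nat :=
  match a, b with
  | 0, 1 | 1, 0 => 0
  | 0, 2 | 2, 0 => 1
  | 0, 3 | 3, 0 => 2
  | 1, 2 | 2, 1 => 3
  | 1, 3 | 3, 1 => 4
  | 2, 3 | 3, 2 => 5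
  | _, _ => 0
  end.

(* index of the edge {a,b} (meaningful for a <> b) *)
Definition eidx (a b : 'I_4) : 'I_6 := inord (eidx_nat a b).

Section Loci.
Variable C : fieldType.

Definition lcoord (x : 'cV[C]_6) (a b : 'I_4) : C := x (eidx a b) ord0.

(* The 3x3 matrix of the context, with vertex 4 as base point. *)
Definition gram4 (x : 'cV[C]_6) : 'M[C]_3 :=
  \matrix_(i < 3, j < 3)
    let a : 'I_4 := widen_ord (leqnSn 3) i in
    let b : 'I_4 := widen_ord (leqnSn 3) j in
    let d : 'I_4 := ord_max in
    if i == j then 2 * lcoord x a d ^+ 2
    else lcoord x a d ^+ 2 + lcoord x b d ^+ 2 - lcoord x a b ^+ 2.

Definition L24 : 'cV[C]_6 -> Prop := fun x => \det (gram4 x) = 0.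

Definition L14 : 'cV[C]_6 -> Prop := fun x =>
  exists p : 'I_4 -> C, forall a b : 'I_4, a != b ->
    lcoord x a b ^+ 2 = (p a - p b) ^+ 2.

Definition vanishing_ideal (V : 'cV[C]_6 -> Prop) : {mpoly C[6]} -> Prop :=
  fun g => forall x, V x -> g.@[fun i => x i ord0] = 0.

Definition zariski_tangent (V : 'cV[C]_6 -> Prop) (x : 'cV[C]_6)
  : 'cV[C]_6 -> Prop :=
  fun v => forall g, vanishing_ideal V g ->
    \sum_(i < 6) (mderiv i g).@[fun k => x k ord0] * v i ord0 = 0.

(* Singular locus of the hypersurface L_{2,4}.  L_{2,4} is the zero set of
   a nonzero polynomial in C^6, hence has local dimension 5 at each of its
   points; the Zariski tangent space (a subspace of C^6) has dimension > 5
   iff it is all of C^6. *)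
Definition sing_L24 : 'cV[C]_6 -> Prop := fun x =>
  L24 x /\ (forall v : 'cV[C]_6, zariski_tangent L24 x v).

Definition erow (a b : 'I_4) : 'rV[C]_6 := delta_mx ord0 (eidx a b).

Definition sgn (s : bool) : C := if s then 1 else -1.

Definition mx3 (r1 r2 r3 : 'rV[C]_6) : 'M[C]_(3, 6) :=
  \matrix_(i < 3, j < 6)
    (if (i : nat) == 0%N then r1 ord0 j
     else if (i : nat) == 1%N then r2 ord0 j else r3 ord0 j).

Definition v1 : 'I_4 := inord 0.
Definition v2 : 'I_4 := inord 1.
Definition v3 : 'I_4 := inord 2.
Definition v4 : 'I_4 := inord 3.

Definition typeI_mx (s : {ffun 'I_5 -> bool}) : 'M[C]_(3, 6) :=
  let s13 := sgn (s (inord 0)) in let s23 := sgn (s (inord 1)) in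
  let s14 := sgn (s (inord 2)) in let s24 := sgn (s (inord 3)) in
  let s34 := sgn (s (inord 4)) in
  mx3 (erow v1 v2 - s13 *: erow v1 v3 + s23 *: erow v2 v3)
      (erow v1 v2 - s14 *: erow v1 v4 + s24 *: erow v2 v4)
      (s13 *: erow v1 v3 - s14 *: erow v1 v4 + s34 *: erow v3 v4).

Definition edge_split (k : 'I_6) : 'I_4 * 'I_4 * 'I_4 * 'I_4 :=
  match (k : nat) with
  | 0 => (v1, v2, v3, v4)
  | 1 => (v1, v3, v2, v4)
  | 2 => (v1, v4, v2, v3)
  | 3 => (v2, v3, v1, v4)
  | 4 => (v2, v4, v1, v3)
  | _ => (v3, v4, v1, v2)
  end.

Definition typeII_mx (k : 'I_6) (e1 e2 : bool) : 'M[C]_(3, 6) :=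
  let: (a, b, c, e) := edge_split k in
  mx3 (erow a b)
      (erow a c - sgn e1 *: erow b c)
      (erow a e - sgn e2 *: erow b e).

Definition triangle (t : 'I_4) : 'I_4 * 'I_4 * 'I_4 :=
  match (t : nat) with
  | 0 => (v2, v3, v4)
  | 1 => (v1, v3, v4)
  | 2 => (v1, v2, v4)
  | _ => (v1, v2, v3)
  end.

Definition typeIII_mx (t : 'I_4) : 'M[C]_(3, 6) :=
  let: (a, b, c) := triangle t in mx3 (erow a b) (erow a c) (erow b c).

Definition sing_index : finType :=
  ({ffun 'I_5 -> bool} + ('I_6 * bool * bool) + 'I_4)%type.

Definition sing_mx (k : sing_index) : 'M[C]_(3, 6) :=
  match k with
  | inl (inl s) => typeI_mx s
  | inl (inr (e, e1, e2)) => typeII_mx e e1 e2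
  | inr t => typeIII_mx t
  end.

Definition kerset (M : 'M[C]_(3, 6)) : 'cV[C]_6 -> Prop :=
  fun x => M *m x = 0.

End Loci.

(* Main.v *)
Require Import Defs.
From HB Require Import structures.
From mathcomp Require Import all_boot all_order all_algebra.
From mathcomp Require Import mpoly complex reals.
From mathcomp Require Import ring.
Import Order.TTheory GRing.Theory Num.Theory.
Set Implicit Arguments. Unset Strict Implicit. Unset Printing Implicit Defensive.
Local Open Scope ring_scope.

(* Let [cm] be the Cayley-Menger determinant as a polynomial in the squared
   lengths [m_ij = l_ij^2], and [W_ij] its partial derivatives.  The gradient of
   the equation of [L_{2,4}] vanishes at [l] iff [l_ij W_ij = 0] for all edges.
   On [cm = 0] the [W_ij] are the off-diagonal entries of a symmetric matrix of
   rank at most one with zero row sums, [W_ij = c w_i w_j].  If [w = 0], the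
   points lie on a line (type I).  Otherwise every edge in the support of [w] has
   length zero; a support of two vertices [a, b] forces [m_ac = m_bc] and
   [m_ae = m_be] (type II), and a larger support contains a triangle of zero
   edges (type III).

   That the Zariski tangent space is cut out by this single gradient needs no
   Nullstellensatz.  If [l_12 <> 0] and [g] vanishes on [L_{2,4}], restrict [g] to
   a family of lines in the direction [l_34] and pseudo-divide by [cm], a quartic
   in [l_34] with leading coefficient [-2 l_12^2]: the remainder vanishes at four
   distinct points for almost all parameters, hence identically, so [g] vanishes
   to order two along a line through a critical point as soon as [cm] does. *)

(** * The Cayley-Menger polynomial and the vanishing of its weighted gradient *)

Definition cm (A : comPzRingType) (m12 m13 m14 m23 m24 m34 : A) : A :=
  8 * m14 * m24 * m34
  + 2 * (m14 + m24 - m12) * (m14 + m34 - m13) * (m24 + m34 - m23)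
  - 2 * m14 * (m24 + m34 - m23) ^+ 2 - 2 * m24 * (m14 + m34 - m13) ^+ 2
  - 2 * m34 * (m14 + m24 - m12) ^+ 2.

(* The derivative of [cm] in [m12]; the other partial derivatives are obtained by
   relabelling the vertices. *)
Definition dcm (A : comPzRingType) (m12 m13 m14 m23 m24 m34 : A) : A :=
  4 * m34 * (m14 + m24 - m12)
  - 2 * (m14 + m34 - m13) * (m24 + m34 - m23).

Lemma cm_morph (A B : comPzRingType) (f : {rmorphism A -> B}) a b c d e g :
  f (cm a b c d e g) = cm (f a) (f b) (f c) (f d) (f e) (f g).
Proof. by rewrite /cm; ring. Qed.

Section Critical.
Variable F : fieldType.

(** If [W12] is nonzero, vertices 1 and 2 lie in the support of [w]. Either 3 and 4 both lie outside
    it, which gives the type II equations, or one of them lies in it and closes a triangle of zero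
    edges. *)
Lemma cm_pivot (m12 m13 m14 m23 m24 m34 : F) :
  cm m12 m13 m14 m23 m24 m34 = 0 ->
  m12 = 0 ->
  dcm m12 m13 m14 m23 m24 m34 != 0 ->
  m13 * dcm m13 m12 m14 m23 m34 m24 = 0 ->
  m14 * dcm m14 m13 m12 m34 m24 m23 = 0 ->
  m23 * dcm m23 m12 m24 m13 m34 m14 = 0 ->
  m24 * dcm m24 m23 m12 m34 m14 m13 = 0 ->
  [\/ m13 = m23 /\ m14 = m24, m13 = 0 /\ m23 = 0 | m14 = 0 /\ m24 = 0].
Proof.
move=> cm0 m12_0.
set W12 := dcm m12 m13 m14 m23 m24 m34.
set W13 := dcm m13 _ _ _ _ _; set W14 := dcm m14 _ _ _ _ _.
set W23 := dcm m23 _ _ _ _ _; set W24 := dcm m24 _ _ _ _ _.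
move=> W12n0 /eqP; rewrite mulf_eq0 => z13 /eqP; rewrite mulf_eq0 => z14.
move=> /eqP; rewrite mulf_eq0 => z23 /eqP; rewrite mulf_eq0 => z24.
have key (U V O c : F) :
    W12 * U = O * V + c * cm m12 m13 m14 m23 m24 m34 -> V = 0 -> U = 0.
  rewrite cm0 mulr0 addr0 => + V0; move/eqP.
  by rewrite V0 mulr0 mulf_eq0 (negbTE W12n0) => /eqP.
(* [e1] to [e4] are 2x2 minors modulo [cm], such as [W12 W13 = W11 W23]; the zero row sums give the
   diagonal entries [W11 = -(W12 + W13 + W14)] and [W22 = -(W12 + W23 + W24)]. *)
have e1 : W12 * W13 = - (W12 + W13 + W14) * W23
      + 4 * (m24 + m34 - m23) * cm m12 m13 m14 m23 m24 m34.
  by rewrite /W12 /W13 /W14 /W23 /cm /dcm; ring.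
have e2 : W12 * W23 = - (W12 + W23 + W24) * W13
      + 4 * (m14 + m34 - m13) * cm m12 m13 m14 m23 m24 m34.
  by rewrite /W12 /W13 /W24 /W23 /cm /dcm; ring.
have e3 : W12 * W14 = - (W12 + W13 + W14) * W24
      + 4 * (m23 + m34 - m24) * cm m12 m13 m14 m23 m24 m34.
  by rewrite /W12 /W13 /W14 /W24 /cm /dcm; ring.
have e4 : W12 * W24 = - (W12 + W23 + W24) * W14
      + 4 * (m13 + m34 - m14) * cm m12 m13 m14 m23 m24 m34.
  by rewrite /W12 /W14 /W24 /W23 /cm /dcm; ring.
have [W13_0|W13n0] := eqVneq W13 0; last first.
  have W23n0 : W23 != 0 by apply: contraNneq W13n0 => /(key _ _ _ _ e1) ->.
  by apply: Or32; move: z13 z23; rewrite (negbTE W13n0) (negbTE W23n0) !orbF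
    => /eqP-> /eqP->.
have W23_0 := key _ _ _ _ e2 W13_0.
have [W14_0|W14n0] := eqVneq W14 0; last first.
  have W24n0 : W24 != 0 by apply: contraNneq W14n0 => /(key _ _ _ _ e3) ->.
  by apply: Or33; move: z14 z24; rewrite (negbTE W14n0) (negbTE W24n0) !orbF
    => /eqP-> /eqP->.
have W24_0 := key _ _ _ _ e4 W14_0.
(* Cramer's rule for the bordered Cayley-Menger matrix: the column [(W12, W22, W23, W24)] has the
   same product with row 1 of [(m_ij)] as with row 3 ([f3]) and row 4 ([f4]). *)
have f3 : W12 * (m13 - m23 + m12)
    = W23 * (m13 + m23 - m12) + W24 * (m14 - m34 + m23 - m12).
  by rewrite /W12 /W23 /W24 /dcm; ring.
have f4 : W12 * (m14 - m24 + m12)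
    = W24 * (m14 + m24 - m12) + W23 * (m13 - m34 + m24 - m12).
  by rewrite /W12 /W23 /W24 /dcm; ring.
apply: Or31; split; apply/eqP; rewrite -subr_eq0.
  move/eqP: f3; rewrite W23_0 W24_0 !mul0r addr0 mulf_eq0 (negbTE W12n0) /=.
  by rewrite m12_0 addr0.
move/eqP: f4; rewrite W23_0 W24_0 !mul0r addr0 mulf_eq0 (negbTE W12n0) /=.
by rewrite m12_0 addr0.
Qed.

Definition on_line (m12 m13 m14 m23 m24 m34 : F) : Prop :=
  exists p1 p2 p3 p4 : F,
    [/\ m12 = (p1 - p2) ^+ 2, m13 = (p1 - p3) ^+ 2 & m14 = (p1 - p4) ^+ 2] /\
    [/\ m23 = (p2 - p3) ^+ 2, m24 = (p2 - p4) ^+ 2 & m34 = (p3 - p4) ^+ 2].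

(* All the partial derivatives vanish iff the Gram matrix has rank at most one:
   place the first vertex at [0] and the second at [l12]. *)
Lemma dcm_eq0_on_line (l12 m13 m14 m23 m24 m34 : F) :
  (2 : F) != 0 -> l12 != 0 ->
  dcm (l12 ^+ 2) m13 m14 m23 m24 m34 = 0 ->
  dcm m13 (l12 ^+ 2) m14 m23 m34 m24 = 0 ->
  dcm m14 m13 (l12 ^+ 2) m34 m24 m23 = 0 ->
  dcm m23 (l12 ^+ 2) m24 m13 m34 m14 = 0 ->
  dcm m24 m23 (l12 ^+ 2) m34 m14 m13 = 0 ->
  dcm m34 m13 m23 m14 m24 (l12 ^+ 2) = 0 ->
  on_line (l12 ^+ 2) m13 m14 m23 m24 m34.
Proof.
move=> n2 nl W12 W13 W14 W23 W24 W34.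
(* The last two positions come from the law of cosines, [2 l12 p3 = l12^2 + m13 - m23], and
   similarly for [p4]. *)
exists 0, l12, ((l12 ^+ 2 + m13 - m23) / (2 * l12)),
  ((l12 ^+ 2 + m14 - m24) / (2 * l12)).
(* The sum [W14 + W24 + W34] is twice [4 m12 m13 - (m12 + m13 - m23)^2], which is sixteen times the
   squared area of the triangle 123. *)
have d4 : (l12 ^+ 2 + m13 - m23) ^+ 2 = 4 * l12 ^+ 2 * m13.
  apply/esym/eqP; rewrite -subr_eq0; apply/eqP/(mulfI n2); rewrite mulr0.
  transitivity (dcm m14 m13 (l12 ^+ 2) m34 m24 m23
     + dcm m24 m23 (l12 ^+ 2) m34 m14 m13 + dcm m34 m13 m23 m14 m24 (l12 ^+ 2)).
    by rewrite /dcm; ring.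
  by rewrite W14 W24 W34 !addr0.
have d3 : (l12 ^+ 2 + m14 - m24) ^+ 2 = 4 * l12 ^+ 2 * m14.
  apply/esym/eqP; rewrite -subr_eq0; apply/eqP/(mulfI n2); rewrite mulr0.
  transitivity (dcm m13 (l12 ^+ 2) m14 m23 m34 m24
     + dcm m23 (l12 ^+ 2) m24 m13 m34 m14 + dcm m34 m13 m23 m14 m24 (l12 ^+ 2)).
    by rewrite /dcm; ring.
  by rewrite W13 W23 W34 !addr0.
have d34 : (l12 ^+ 2 + m13 - m23) * (l12 ^+ 2 + m14 - m24)
         = 2 * l12 ^+ 2 * (m13 + m14 - m34).
  apply/eqP; rewrite eq_sym -subr_eq0; apply/eqP/(mulfI n2); rewrite mulr0 -W34.
  by rewrite /dcm; ring.
have E3 : m13 = ((l12 ^+ 2 + m13 - m23) / (2 * l12)) ^+ 2.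
  by rewrite expr_div_n d4; field; rewrite nl n2.
have E4 : m14 = ((l12 ^+ 2 + m14 - m24) / (2 * l12)) ^+ 2.
  by rewrite expr_div_n d3; field; rewrite nl n2.
have E34 : (l12 ^+ 2 + m13 - m23) / (2 * l12)
         * ((l12 ^+ 2 + m14 - m24) / (2 * l12)) = (m13 + m14 - m34) / 2.
  by rewrite mulrACA d34; field; rewrite nl n2.
split; split.
- by ring.
- by rewrite sub0r sqrrN.
- by rewrite sub0r sqrrN.
- by rewrite sqrrB -E3; field; rewrite nl n2.
- by rewrite sqrrB -E4; field; rewrite nl n2.
- by rewrite sqrrB -E3 -E4 E34; field; rewrite n2.
Qed.

End Critical.

(** * Edge coordinates, equations of the three types of subspaces, and their ranks *)

Lemma vertexE :
  ((v1 = 0%N :> nat) * (v2 = 1%N :> nat) * (v3 = 2%N :> nat) * (v4 = 3%N :> nat))%type.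
Proof. by rewrite /v1 /v2 /v3 /v4 !inordK. Qed.

Lemma eidxC a b : eidx a b = eidx b a.
Proof.
by congr inord; case: a b => [[|[|[|[|?]]]] ?] [[|[|[|[|?]]]] ?].
Qed.

Lemma eidxE a b : eidx a b = eidx_nat a b :> nat.
Proof.
by rewrite inordK //; case: a b => [[|[|[|[|?]]]] ?] [[|[|[|[|?]]]] ?].
Qed.

Lemma ord4_vertex (a : 'I_4) : [\/ a = v1, a = v2 | a = v3] \/ a = v4.
Proof.
case: a => [[|[|[|[|?]]]] lt_a] //.
- by left; apply: Or31; apply/val_inj; rewrite /= vertexE.
- by left; apply: Or32; apply/val_inj; rewrite /= vertexE.
- by left; apply: Or33; apply/val_inj; rewrite /= vertexE.
- by right; apply/val_inj; rewrite /= vertexE.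
Qed.

Section Coordinates.
Variable F : fieldType.
Implicit Types (x : 'cV[F]_6) (a b c d : 'I_4) (s : {ffun 'I_5 -> bool}).

Lemma lcoordC x a b : lcoord x a b = lcoord x b a.
Proof. by rewrite /lcoord eidxC. Qed.

Let mx_linE : (forall m n (A B : 'M[F]_(m, n)) i j, (A + B) i j = A i j + B i j)
  * (forall m n (A : 'M[F]_(m, n)) i j, (- A) i j = - A i j)
  * (forall m n k (A : 'M[F]_(m, n)) i j, (k *: A) i j = k * A i j).
Proof. by do !split=> *; rewrite mxE. Qed.

Lemma erow_mul x a b : (erow F a b *m x) ord0 ord0 = lcoord x a b.
Proof. by rewrite /erow -rowE mxE. Qed.

Lemma erowE a b c d :
  (erow F a b) ord0 (eidx c d) = (eidx_nat c d == eidx_nat a b)%:R.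
Proof. by rewrite mxE eqxx -val_eqE /= !eidxE. Qed.

Lemma kerset_mx3 (r1 r2 r3 : 'rV[F]_6) x : kerset (mx3 r1 r2 r3) x <->
  [/\ (r1 *m x) ord0 ord0 = 0, (r2 *m x) ord0 ord0 = 0
    & (r3 *m x) ord0 ord0 = 0].
Proof.
have E (i : 'I_3) : (mx3 r1 r2 r3 *m x) i ord0
    = ((if (i : nat) == 0%N then r1 else if (i : nat) == 1%N then r2 else r3)
        *m x) ord0 ord0.
  rewrite !mxE; apply: eq_bigr => j _; rewrite mxE.
  by case: ifP => // _; case: ifP.
split=> [K|[K1 K2 K3]].
  split; first by rewrite -(E ord0) K mxE.
    by rewrite -(E (@Ordinal 3 1 isT)) K mxE.
  by rewrite -(E (@Ordinal 3 2 isT)) K mxE.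
by apply/matrixP=> i j; rewrite ord1 E [RHS]mxE; case: ifP => // _; case: ifP.
Qed.

Lemma kerset_typeI s x : kerset (typeI_mx F s) x <->
  [/\ lcoord x v1 v2 - sgn F (s (inord 0)) * lcoord x v1 v3
        + sgn F (s (inord 1)) * lcoord x v2 v3 = 0,
      lcoord x v1 v2 - sgn F (s (inord 2)) * lcoord x v1 v4
        + sgn F (s (inord 3)) * lcoord x v2 v4 = 0
    & sgn F (s (inord 0)) * lcoord x v1 v3 - sgn F (s (inord 2)) * lcoord x v1 v4
        + sgn F (s (inord 4)) * lcoord x v3 v4 = 0].
Proof.
rewrite /typeI_mx kerset_mx3 !mulmxDl !mulNmx -!scalemxAl.
by rewrite !mx_linE !erow_mul.
Qed.

Lemma kerset_typeII k e1 e2 x : kerset (typeII_mx F k e1 e2) x <->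
  let: (a, b, c, e) := edge_split k in
  [/\ lcoord x a b = 0, lcoord x a c = sgn F e1 * lcoord x b c
    & lcoord x a e = sgn F e2 * lcoord x b e].
Proof.
rewrite /typeII_mx; case: (edge_split k) => [[[a b] c] e].
rewrite kerset_mx3 !mulmxDl !mulNmx -!scalemxAl.
rewrite !mx_linE !erow_mul.
by split=> -[-> A B]; split=> //; apply/eqP; move/eqP: A; move/eqP: B;
  rewrite ?subr_eq0.
Qed.

Lemma kerset_typeIII t x : kerset (typeIII_mx F t) x <->
  let: (a, b, c) := triangle t in
  [/\ lcoord x a b = 0, lcoord x a c = 0 & lcoord x b c = 0].
Proof.
rewrite /typeIII_mx; case: (triangle t) => [[a b] c].
by rewrite kerset_mx3 !erow_mul.
Qed.

Lemma sgn_sqr e : sgn F e ^+ 2 = 1.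
Proof. by case: e; rewrite /sgn ?sqrrN expr1n. Qed.

Lemma sgn_neq0 e : sgn F e != 0.
Proof. by case: e; rewrite /sgn ?oppr_eq0 oner_eq0. Qed.

Lemma sqr_eq_sgn (u v : F) : u ^+ 2 = v ^+ 2 -> exists e, u = sgn F e * v.
Proof.
move=> /eqP; rewrite eqf_sqr => /orP[]/eqP->.
  by exists true; rewrite mul1r.
by exists false; rewrite mulN1r.
Qed.

(* Writing [l_ij = e_ij (p_i - p_j)], the signs of the subspace containing [x]
   are the products [e_12 e_ij]. *)
Lemma L14_typeI x : L14 x <-> exists s, kerset (typeI_mx F s) x.
Proof.
split=> [[p Lp]|[s]].
  have sg a b : a != b -> exists e, p a - p b = sgn F e * lcoord x a b.
    by move=> nab; apply/sqr_eq_sgn; rewrite Lp.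
  have ne : [/\ v1 != v2, v1 != v3 & v1 != v4] /\ [/\ v2 != v3, v2 != v4 & v3 != v4].
    by rewrite -!val_eqE /= !vertexE.
  case: ne => -[n12 n13 n14] [n23 n24 n34].
  have [e12 E12] := sg _ _ n12; have [e13 E13] := sg _ _ n13.
  have [e14 E14] := sg _ _ n14; have [e23 E23] := sg _ _ n23.
  have [e24 E24] := sg _ _ n24; have [e34 E34] := sg _ _ n34.
  pose es := [:: e12 == e13; e12 == e23; e12 == e14; e12 == e24; e12 == e34].
  exists [ffun i : 'I_5 => nth true es i].
  have sgnM e e' : sgn F (e == e') = sgn F e * sgn F e'.
    by case: e e' => -[]; rewrite /sgn /= ?mulr1 ?mulrNN ?mul1r ?mulr1.
  rewrite kerset_typeI !ffunE !inordK //= !sgnM -!mulrA -E13 -E14 -E23 -E24 -E34.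
  have -> : lcoord x v1 v2 = sgn F e12 * (p v1 - p v2).
    by rewrite E12 mulrA -expr2 sgn_sqr mul1r.
  by split; ring.
rewrite kerset_typeI; set s13 := sgn F _; set s23 := sgn F _.
set s14 := sgn F _; set s24 := sgn F _; set s34 := sgn F _ => -[E1 E2 E3].
(* Conversely, vertex 1 is placed at 0 and vertex [j] at [- s_1j l_1j], with [s_12 = 1]; the three
   equations then account for the edges 23, 24 and 34. *)
pose q := [:: 0; - lcoord x v1 v2; - (s13 * lcoord x v1 v3);
   - (s14 * lcoord x v1 v4)].
have sq (c l : F) : c ^+ 2 = 1 -> l ^+ 2 = (c * l) ^+ 2.
  by move=> c1; rewrite exprMn c1 mul1r.
have e23 : lcoord x v2 v3 ^+ 2 = (q`_1 - q`_2) ^+ 2.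
  rewrite (sq s23 _ (sgn_sqr _)) /=; congr (_ ^+ 2); apply/eqP.
  by rewrite -subr_eq0; apply/eqP; rewrite -E1; ring.
have e24 : lcoord x v2 v4 ^+ 2 = (q`_1 - q`_3) ^+ 2.
  rewrite (sq s24 _ (sgn_sqr _)) /=; congr (_ ^+ 2); apply/eqP.
  by rewrite -subr_eq0; apply/eqP; rewrite -E2; ring.
have e34 : lcoord x v3 v4 ^+ 2 = (q`_2 - q`_3) ^+ 2.
  rewrite (sq s34 _ (sgn_sqr _)) /=; congr (_ ^+ 2); apply/eqP.
  by rewrite -subr_eq0; apply/eqP; rewrite -E3; ring.
have e12 : lcoord x v1 v2 ^+ 2 = (q`_0 - q`_1) ^+ 2 by rewrite /=; ring.
have e13 : lcoord x v1 v3 ^+ 2 = (q`_0 - q`_2) ^+ 2.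
  by rewrite (sq s13 _ (sgn_sqr _)) /=; ring.
have e14 : lcoord x v1 v4 ^+ 2 = (q`_0 - q`_3) ^+ 2.
  by rewrite (sq s14 _ (sgn_sqr _)) /=; ring.
exists (fun a => q`_a) => a b.
by case: (ord4_vertex a) => [[]|] ->; case: (ord4_vertex b) => [[]|] ->;
  rewrite ?eqxx // !vertexE => _ //; rewrite lcoordC -[RHS]sqrrN opprB.
Qed.

Lemma det_gram4 x : \det (gram4 x) =
  cm (lcoord x v1 v2 ^+ 2) (lcoord x v1 v3 ^+ 2) (lcoord x v1 v4 ^+ 2)
     (lcoord x v2 v3 ^+ 2) (lcoord x v2 v4 ^+ 2) (lcoord x v3 v4 ^+ 2).
Proof.
rewrite (expand_det_row _ ord0) !big_ord_recl big_ord0 /cofactor.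
rewrite !(expand_det_row _ ord0) !big_ord_recl !big_ord0 /cofactor !det_mx11.
rewrite !mxE /=.
rewrite /lcoord /eidx !vertexE /= /bump /= /cm.
by ring.
Qed.

(** The columns [j1], [j2], [j3] form an invertible diagonal block, so the rows are independent. *)
Lemma mx3_rank (r1 r2 r3 : 'rV[F]_6) (j1 j2 j3 : 'I_6) :
  r1 ord0 j1 != 0 -> r2 ord0 j1 = 0 -> r3 ord0 j1 = 0 ->
  r1 ord0 j2 = 0 -> r2 ord0 j2 != 0 -> r3 ord0 j2 = 0 ->
  r1 ord0 j3 = 0 -> r2 ord0 j3 = 0 -> r3 ord0 j3 != 0 ->
  \rank (mx3 r1 r2 r3) = 3%N.
Proof.
move=> n1 z21 z31 z12 n2 z32 z13 z23 n3.
apply/eqP/inj_row_free => v v0.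
have E j : v ord0 ord0 * r1 ord0 j + (v ord0 (lift ord0 ord0) * r2 ord0 j
     + v ord0 (lift ord0 (lift ord0 ord0)) * r3 ord0 j) = 0.
  have := congr1 (fun A : 'rV[F]_6 => A ord0 j) v0.
  by rewrite !mxE !big_ord_recl big_ord0 !mxE /= addr0.
have u1 : v ord0 ord0 = 0.
  by apply/(mulIf n1); rewrite mul0r -(E j1) z21 z31 !mulr0 !addr0.
have u2 : v ord0 (lift ord0 ord0) = 0.
  by apply/(mulIf n2); rewrite mul0r -(E j2) z12 z32 !mulr0 add0r addr0.
have u3 : v ord0 (lift ord0 (lift ord0 ord0)) = 0.
  by apply/(mulIf n3); rewrite mul0r -(E j3) z13 z23 !mulr0 !add0r.
apply/rowP => i; rewrite !mxE.
case: i => [[|[|[|//]]] lt_i].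
- by rewrite -[RHS]u1; congr (v _ _); apply/val_inj.
- by rewrite -[RHS]u2; congr (v _ _); apply/val_inj.
- by rewrite -[RHS]u3; congr (v _ _); apply/val_inj.
Qed.

Lemma ord6_ind (P : 'I_6 -> Prop) :
  P (inord 0) -> P (inord 1) -> P (inord 2) -> P (inord 3) -> P (inord 4) ->
  P (inord 5) -> forall k, P k.
Proof.
by move=> P0 P1 P2 P3 P4 P5 k; rewrite -[k]inord_val;
  case: k => [[|[|[|[|[|[|?]]]]]] ?].
Qed.

Lemma ord4_ind (P : 'I_4 -> Prop) :
  P (inord 0) -> P (inord 1) -> P (inord 2) -> P (inord 3) -> forall k, P k.
Proof.
by move=> P0 P1 P2 P3 k; rewrite -[k]inord_val;
  case: k => [[|[|[|[|?]]]] ?].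
Qed.

Lemma sing_mx_rank k : \rank (sing_mx F k) = 3%N.
Proof.
have n1 : (1 : F) != 0 := oner_neq0 _.
case: k => [[s|[[k e1] e2]]|t] /=.
(* Each of the edges 23, 24, 34 occurs in exactly one of the three type I equations. *)
- apply: (@mx3_rank _ _ _ (eidx v2 v3) (eidx v2 v4) (eidx v3 v4));
    rewrite ?mx_linE !erowE !vertexE /= ?mulr0 ?mulr1 ?oppr0 ?addr0 ?add0r ?sgn_neq0 //.
- elim/ord6_ind: k; rewrite /typeII_mx /edge_split inordK //;
    match goal with |- context [mx3 (erow _ ?a ?b) (erow _ _ ?c - _) (erow _ _ ?e - _)] =>
    apply: (@mx3_rank _ _ _ (eidx a b) (eidx a c) (eidx a e)) end;
    rewrite ?mx_linE !erowE !vertexE /= ?mulr0 ?mulr1 ?oppr0 ?addr0 ?add0r //.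
- elim/ord4_ind: t; rewrite /typeIII_mx /triangle inordK //;
    match goal with |- context [mx3 (erow _ ?a ?b) _ (erow _ _ ?c)] =>
    apply: (@mx3_rank _ _ _ (eidx a b) (eidx a c) (eidx b c)) end;
    rewrite !erowE !vertexE /= //.
Qed.

End Coordinates.

(** * The critical points are the points of the 60 subspaces *)

Section Classification.
Variable F : fieldType.
Implicit Types (x : 'cV[F]_6) (a b c d : 'I_4).

(** By the chain rule the gradient in the lengths has components [2 l_ij W_ij]; the factor 2 is left
    out here. *)
Definition critical x : Prop :=
  let l := lcoord x in
  let m12 := l v1 v2 ^+ 2 in let m13 := l v1 v3 ^+ 2 in
  let m14 := l v1 v4 ^+ 2 in let m23 := l v2 v3 ^+ 2 in
  let m24 := l v2 v4 ^+ 2 in let m34 := l v3 v4 ^+ 2 in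
  [/\ cm m12 m13 m14 m23 m24 m34 = 0,
  [/\ l v1 v2 * dcm m12 m13 m14 m23 m24 m34 = 0,
      l v1 v3 * dcm m13 m12 m14 m23 m34 m24 = 0
    & l v1 v4 * dcm m14 m13 m12 m34 m24 m23 = 0] &
  [/\ l v2 v3 * dcm m23 m12 m24 m13 m34 m14 = 0,
      l v2 v4 * dcm m24 m23 m12 m34 m14 m13 = 0
    & l v3 v4 * dcm m34 m13 m23 m14 m24 m12 = 0]].

(** For type I, a configuration on a line replaces the linear equations, and every expression
    vanishes identically in the positions of the points. For the other types the equations are
    substituted directly. *)
Lemma sing_mx_critical k x : kerset (sing_mx F k) x -> critical x.
Proof.
case: k => [[s|[[k e1] e2]]|t] /=.
- move=> Ks; have [|p Lp] := (L14_typeI x).2; first by exists s.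
  have ne : [/\ v1 != v2, v1 != v3 & v1 != v4] /\ [/\ v2 != v3, v2 != v4 & v3 != v4].
    by rewrite -!val_eqE /= !vertexE.
  case: ne => -[n12 n13 n14] [n23 n24 n34].
  by rewrite /critical !Lp // /cm /dcm; do !split; ring.
- rewrite kerset_typeII.
  have sq (u v : F) (e : bool) : u = sgn F e * v -> u ^+ 2 = v ^+ 2.
    by move->; rewrite exprMn sgn_sqr mul1r.
  by elim/ord6_ind: k; rewrite /edge_split inordK // => -[E1 /sq E2 /sq E3];
    rewrite /critical;
    move: E1 E2 E3; rewrite ?(lcoordC _ v2 v1) ?(lcoordC _ v3 v1)
      ?(lcoordC _ v3 v2) ?(lcoordC _ v4 v1) ?(lcoordC _ v4 v2)
      ?(lcoordC _ v4 v3) => E1 E2 E3; rewrite E1 E2 E3 /cm /dcm; do !split; ring.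
- rewrite kerset_typeIII.
  by elim/ord4_ind: t; rewrite /triangle inordK // => -[E1 E2 E3];
    rewrite /critical E1 E2 E3 /cm /dcm; do !split; ring.
Qed.

Lemma typeII_sing k x :
  (let: (a, b, c, e) := edge_split k in
   [/\ lcoord x a b = 0, lcoord x a c ^+ 2 = lcoord x b c ^+ 2
     & lcoord x a e ^+ 2 = lcoord x b e ^+ 2]) ->
  exists k, kerset (sing_mx F k) x.
Proof.
have Kk0 e1 e2 := @kerset_typeII F k e1 e2 x; move: Kk0.
case: (edge_split k) => [[[a b] c] e] Kk [E0 /sqr_eq_sgn[e1 E1] /sqr_eq_sgn[e2 E2]].
by exists (inl (inr (k, e1, e2))); apply/Kk.
Qed.

Lemma typeIII_sing t x :
  (let: (a, b, c) := triangle t in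
   [/\ lcoord x a b = 0, lcoord x a c = 0 & lcoord x b c = 0]) ->
  exists k, kerset (sing_mx F k) x.
Proof. by move=> Et; exists (inr t); apply/kerset_typeIII. Qed.

Lemma on_line_sing x :
  on_line (lcoord x v1 v2 ^+ 2) (lcoord x v1 v3 ^+ 2) (lcoord x v1 v4 ^+ 2)
     (lcoord x v2 v3 ^+ 2) (lcoord x v2 v4 ^+ 2) (lcoord x v3 v4 ^+ 2) ->
  exists k, kerset (sing_mx F k) x.
Proof.
case=> p1 [p2 [p3 [p4 [[E12 E13 E14] [E23 E24 E34]]]]].
suff /L14_typeI[s Ks] : L14 x by exists (inl (inl s)).
exists (fun a => nth 0 [:: p1; p2; p3; p4] a) => a b.
by case: (ord4_vertex a) => [[]|] ->; case: (ord4_vertex b) => [[]|] ->;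
  rewrite ?eqxx // !vertexE => _ //; rewrite lcoordC -[RHS]sqrrN opprB.
Qed.

Lemma critical_sing x : (2 : F) != 0 -> critical x ->
  exists k, kerset (sing_mx F k) x.
Proof.
move=> n2; rewrite /critical /=.
have := @on_line_sing x.
have := @typeIII_sing (inord 3) x; have := @typeIII_sing (inord 2) x.
have := @typeIII_sing (inord 1) x; have := @typeIII_sing (inord 0) x.
have := @typeII_sing (inord 5) x; have := @typeII_sing (inord 4) x.
have := @typeII_sing (inord 3) x; have := @typeII_sing (inord 2) x.
have := @typeII_sing (inord 1) x; have := @typeII_sing (inord 0) x.
rewrite /triangle /edge_split !inordK //.
rewrite !(lcoordC _ v3 v2) !(lcoordC _ v4 v2) !(lcoordC _ v4 v3).
rewrite ?(lcoordC _ v3 v1) ?(lcoordC _ v2 v1) ?(lcoordC _ v4 v1).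
set l12 := lcoord x v1 v2; set l13 := lcoord x v1 v3; set l14 := lcoord x v1 v4.
set l23 := lcoord x v2 v3; set l24 := lcoord x v2 v4; set l34 := lcoord x v3 v4.
set P := (exists _, _).
move=> II12 II13 II14 II23 II24 II34 III0 III1 III2 III3 OL.
case=> cm12 [D12 D13 D14] [D23 D24 D34].
have m0 (l w : F) : l * w = 0 -> l ^+ 2 * w = 0.
  by rewrite expr2 -mulrA => ->; rewrite mulr0.
have sq0 (l : F) : l ^+ 2 = 0 -> l = 0.
  by move=> /eqP; rewrite sqrf_eq0 => /eqP.
have nz (l w : F) : l * w = 0 -> w != 0 -> l ^+ 2 = 0.
  move=> /eqP; rewrite mulf_eq0 => /orP[/eqP->|/eqP->].
    by rewrite expr0n.
  by rewrite eqxx.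
(* If [W12] is nonzero then [l12 = 0], and the outcomes of [cm_pivot] are type II at the edge 12,
   the triangle 123 and the triangle 124. The other five edges are treated alike after relabelling
   the vertices. *)
have [W12|W12] := eqVneq (dcm (l12 ^+ 2) (l13 ^+ 2) (l14 ^+ 2)
    (l23 ^+ 2) (l24 ^+ 2) (l34 ^+ 2)) 0; last first.
  have z12 := sq0 _ (nz _ _ D12 W12).
  have [||||[E1 E2]|[E1 E2]|[E1 E2]] := cm_pivot cm12 (nz _ _ D12 W12) W12.
  - by rewrite -(m0 _ _ D13) /dcm; ring.
  - by rewrite -(m0 _ _ D14) /dcm; ring.
  - by rewrite -(m0 _ _ D23) /dcm; ring.
  - by rewrite -(m0 _ _ D24) /dcm; ring.
  - by apply: II12; split.
  - by apply: III3; split=> //; apply: sq0.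
  - by apply: III2; split=> //; apply: sq0.
have cm13 : cm (l13 ^+ 2) (l12 ^+ 2) (l14 ^+ 2) (l23 ^+ 2) (l34 ^+ 2) (l24 ^+ 2) = 0.
  by rewrite -cm12 /cm; ring.
have [W13|W13] := eqVneq (dcm (l13 ^+ 2) (l12 ^+ 2) (l14 ^+ 2)
    (l23 ^+ 2) (l34 ^+ 2) (l24 ^+ 2)) 0; last first.
  have z13 := sq0 _ (nz _ _ D13 W13).
  have [||||[E1 E2]|[E1 E2]|[E1 E2]] := cm_pivot cm13 (nz _ _ D13 W13) W13.
  - by rewrite -(m0 _ _ D12) /dcm; ring.
  - by rewrite -(m0 _ _ D14) /dcm; ring.
  - by rewrite -(m0 _ _ D23) /dcm; ring.
  - by rewrite -(m0 _ _ D34) /dcm; ring.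
  - by apply: II13; split.
  - by apply: III3; split=> //; apply: sq0.
  - by apply: III1; split=> //; apply: sq0.
have cm14 : cm (l14 ^+ 2) (l13 ^+ 2) (l12 ^+ 2) (l34 ^+ 2) (l24 ^+ 2) (l23 ^+ 2) = 0.
  by rewrite -cm12 /cm; ring.
have [W14|W14] := eqVneq (dcm (l14 ^+ 2) (l13 ^+ 2) (l12 ^+ 2)
    (l34 ^+ 2) (l24 ^+ 2) (l23 ^+ 2)) 0; last first.
  have z14 := sq0 _ (nz _ _ D14 W14).
  have [||||[E1 E2]|[E1 E2]|[E1 E2]] := cm_pivot cm14 (nz _ _ D14 W14) W14.
  - by rewrite -(m0 _ _ D13) /dcm; ring.
  - by rewrite -(m0 _ _ D12) /dcm; ring.
  - by rewrite -(m0 _ _ D34) /dcm; ring.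
  - by rewrite -(m0 _ _ D24) /dcm; ring.
  - by apply: II14; split.
  - by apply: III1; split=> //; apply: sq0.
  - by apply: III2; split=> //; apply: sq0.
have cm23 : cm (l23 ^+ 2) (l12 ^+ 2) (l24 ^+ 2) (l13 ^+ 2) (l34 ^+ 2) (l14 ^+ 2) = 0.
  by rewrite -cm12 /cm; ring.
have [W23|W23] := eqVneq (dcm (l23 ^+ 2) (l12 ^+ 2) (l24 ^+ 2)
    (l13 ^+ 2) (l34 ^+ 2) (l14 ^+ 2)) 0; last first.
  have z23 := sq0 _ (nz _ _ D23 W23).
  have [||||[E1 E2]|[E1 E2]|[E1 E2]] := cm_pivot cm23 (nz _ _ D23 W23) W23.
  - by rewrite -(m0 _ _ D12) /dcm; ring.
  - by rewrite -(m0 _ _ D24) /dcm; ring.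
  - by rewrite -(m0 _ _ D13) /dcm; ring.
  - by rewrite -(m0 _ _ D34) /dcm; ring.
  - by apply: II23; split.
  - by apply: III3; split=> //; apply: sq0.
  - by apply: III0; split=> //; apply: sq0.
have cm24 : cm (l24 ^+ 2) (l23 ^+ 2) (l12 ^+ 2) (l34 ^+ 2) (l14 ^+ 2) (l13 ^+ 2) = 0.
  by rewrite -cm12 /cm; ring.
have [W24|W24] := eqVneq (dcm (l24 ^+ 2) (l23 ^+ 2) (l12 ^+ 2)
    (l34 ^+ 2) (l14 ^+ 2) (l13 ^+ 2)) 0; last first.
  have z24 := sq0 _ (nz _ _ D24 W24).
  have [||||[E1 E2]|[E1 E2]|[E1 E2]] := cm_pivot cm24 (nz _ _ D24 W24) W24.
  - by rewrite -(m0 _ _ D23) /dcm; ring.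
  - by rewrite -(m0 _ _ D12) /dcm; ring.
  - by rewrite -(m0 _ _ D34) /dcm; ring.
  - by rewrite -(m0 _ _ D14) /dcm; ring.
  - by apply: II24; split.
  - by apply: III0; split=> //; apply: sq0.
  - by apply: III2; split=> //; apply: sq0.
have cm34 : cm (l34 ^+ 2) (l13 ^+ 2) (l23 ^+ 2) (l14 ^+ 2) (l24 ^+ 2) (l12 ^+ 2) = 0.
  by rewrite -cm12 /cm; ring.
have [W34|W34] := eqVneq (dcm (l34 ^+ 2) (l13 ^+ 2) (l23 ^+ 2)
    (l14 ^+ 2) (l24 ^+ 2) (l12 ^+ 2)) 0; last first.
  have z34 := sq0 _ (nz _ _ D34 W34).
  have [||||[E1 E2]|[E1 E2]|[E1 E2]] := cm_pivot cm34 (nz _ _ D34 W34) W34.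
  - by rewrite -(m0 _ _ D13) /dcm; ring.
  - by rewrite -(m0 _ _ D23) /dcm; ring.
  - by rewrite -(m0 _ _ D14) /dcm; ring.
  - by rewrite -(m0 _ _ D24) /dcm; ring.
  - by apply: II34; split.
  - by apply: III1; split=> //; apply: sq0.
  - by apply: III0; split=> //; apply: sq0.
(* All the [W_ij] vanish from here on. A nonzero edge at vertex 1 serves as the base for placing the
   points on a line. *)
have [z12|n12] := eqVneq l12 0; last first.
  by apply: OL; apply: dcm_eq0_on_line.
have [z13|n13] := eqVneq l13 0; last first.
  apply: OL; have [||||||p1 [p2 [p3 [p4 [[? ? ?] [? ? ?]]]]]] :=
    @dcm_eq0_on_line _ l13 (l12 ^+ 2) (l14 ^+ 2) (l23 ^+ 2) (l34 ^+ 2) (l24 ^+ 2) n2 n13.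
  - by rewrite -W13 /dcm; ring.
  - by rewrite -W12 /dcm; ring.
  - by rewrite -W14 /dcm; ring.
  - by rewrite -W23 /dcm; ring.
  - by rewrite -W34 /dcm; ring.
  - by rewrite -W24 /dcm; ring.
  by exists p1, p3, p2, p4; do !split=> //; rewrite -[RHS]sqrrN opprB.
have [z14|n14] := eqVneq l14 0; last first.
  apply: OL; have [||||||p1 [p2 [p3 [p4 [[? ? ?] [? ? ?]]]]]] :=
    @dcm_eq0_on_line _ l14 (l13 ^+ 2) (l12 ^+ 2) (l34 ^+ 2) (l24 ^+ 2) (l23 ^+ 2) n2 n14.
  - by rewrite -W14 /dcm; ring.
  - by rewrite -W13 /dcm; ring.
  - by rewrite -W12 /dcm; ring.
  - by rewrite -W34 /dcm; ring.
  - by rewrite -W24 /dcm; ring.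
  - by rewrite -W23 /dcm; ring.
  by exists p1, p4, p3, p2; do !split=> //; rewrite -[RHS]sqrrN opprB.
(* When all edges at vertex 1 are zero, [W14 + W24 + W34] reduces to [-2 l23^4], so the triangle 123
   has zero edges. *)
apply: III3; split=> //; apply/sq0/sq0/(mulfI n2)/oppr_inj.
rewrite mulr0 oppr0.
transitivity (
  dcm (l14 ^+ 2) (l13 ^+ 2) (l12 ^+ 2) (l34 ^+ 2) (l24 ^+ 2) (l23 ^+ 2)
  + dcm (l24 ^+ 2) (l23 ^+ 2) (l12 ^+ 2) (l34 ^+ 2) (l14 ^+ 2) (l13 ^+ 2)
  + dcm (l34 ^+ 2) (l13 ^+ 2) (l23 ^+ 2) (l14 ^+ 2) (l24 ^+ 2) (l12 ^+ 2)).
  by rewrite z12 z13 z14 /dcm; ring.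
by rewrite W14 W24 W34 !addr0.
Qed.

End Classification.

(** * The 60 subspaces are pairwise distinct *)

Section Distinct.
Variable C : numFieldType.

Definition edge_col (f : nat -> C) : 'cV[C]_6 := \col_j f j.

Lemma lcoord_edge_col f a b : lcoord (edge_col f) a b = f (eidx_nat a b).
Proof. by rewrite /lcoord mxE eidxE. Qed.

Lemma sgn_int e : sgn C e = (if e then 1 else -1 : int)%:~R.
Proof. by case: e. Qed.

(** Moves a signed sum from [C] to the integers, where wrong signs are refuted by computation. *)
Lemma sgn_lincomb_eq0 (p q r : int) (e e' : bool) :
   p%:~R - sgn C e * q%:~R + sgn C e' * r%:~R = 0 ->
   p - (if e then q else - q) + (if e' then r else - r) = 0.
Proof.
rewrite !sgn_int => E; apply/eqP; rewrite -(intr_eq0 C) -[X in _ == X]E.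
by case: e e' {E} => -[] /=; apply/eqP; ring.
Qed.

Lemma sgn_inj : injective (sgn C).
Proof. by move=> [] [] // /eqP; rewrite !sgn_int eqr_int. Qed.

(* Distances of the collinear points [0, 1, 3, 7]: in each triangle only one sign
   pattern, up to a global sign, makes the three lengths sum to zero. *)
Definition typeI_pt (s : {ffun 'I_5 -> bool}) : 'cV[C]_6 :=
  edge_col (nth 0 [:: 1; 3 * sgn C (s (inord 0)); 7 * sgn C (s (inord 2));
    2 * sgn C (s (inord 1)); 6 * sgn C (s (inord 3)); 4 * sgn C (s (inord 4))]).

(** The edge [k] is the only zero coordinate, and both signs can be read off the point. *)
Definition typeII_pt (k : 'I_6) (e1 e2 : bool) : 'cV[C]_6 :=
  let: (a, b, c, e) := edge_split k in
  edge_col (fun j => if j == eidx_nat a b then 0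
    else if j == eidx_nat a c then sgn C e1
    else if j == eidx_nat a e then sgn C e2 else 1).

Definition typeIII_pt (t : 'I_4) : 'cV[C]_6 :=
  let: (a, b, c) := triangle t in
  edge_col (fun j =>
    if j \in [:: eidx_nat a b; eidx_nat a c; eidx_nat b c] then 0 else 1).

Lemma typeI_ptP s : kerset (typeI_mx C s) (typeI_pt s).
Proof.
rewrite kerset_typeI /typeI_pt !lcoord_edge_col !vertexE /=.
have sgnK (c : C) e : sgn C e * (c * sgn C e) = c.
  by rewrite mulrCA -expr2 sgn_sqr mulr1.
by rewrite !sgnK; split; ring.
Qed.

Lemma typeI_pt_neq0 s a b : lcoord (typeI_pt s) a b != 0.
Proof.
rewrite /typeI_pt lcoord_edge_col.
by case: (ord4_vertex a) => [[]|] ->; case: (ord4_vertex b) => [[]|] ->;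
  rewrite !vertexE /= ?mulf_eq0 ?negb_or ?oner_neq0 ?pnatr_eq0 ?sgn_neq0.
Qed.

Lemma edge_split_eidx k : let: (a, b, c, e) := edge_split k in eidx_nat a b = k.
Proof. by elim/ord6_ind: k; rewrite /edge_split !inordK //= !vertexE. Qed.

Lemma typeII_ptP k e1 e2 : kerset (typeII_mx C k e1 e2) (typeII_pt k e1 e2).
Proof.
rewrite kerset_typeII /typeII_pt.
by elim/ord6_ind: k; rewrite /edge_split !inordK //= !lcoord_edge_col
  !vertexE /= !mulr1.
Qed.

Lemma typeII_pt_eq0 k e1 e2 a b :
  lcoord (typeII_pt k e1 e2) a b = 0 -> eidx_nat a b = k.
Proof.
have := edge_split_eidx k; rewrite /typeII_pt.
case: (edge_split k) => -[[a' b'] c'] e' <-; rewrite lcoord_edge_col.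
case: eqP => // _; do 2?[case: ifP => _]; move=> /eqP; 
  by rewrite ?oner_eq0 ?(negbTE (sgn_neq0 _ _)).
Qed.

Lemma typeIII_ptP t : kerset (typeIII_mx C t) (typeIII_pt t).
Proof.
rewrite kerset_typeIII /typeIII_pt.
by elim/ord4_ind: t; rewrite /triangle !inordK //= !lcoord_edge_col !vertexE.
Qed.

(** Sample points separate the subspaces. The type I point has no zero coordinate, so it satisfies
    no equations of type II or III; the type II point has only one zero edge, so it satisfies none
    of type III. Within one type, the sample point determines the index. *)
Lemma kerset_sing_inj (k k' : sing_index) :
  kerset (sing_mx C k) = kerset (sing_mx C k') -> k = k'.
Proof.
have I_II s i e1 e2 : kerset (typeI_mx C s) <> kerset (typeII_mx C i e1 e2).
  move=> E; have := typeI_ptP s; rewrite E kerset_typeII.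
  by case: (edge_split i) => -[[a b] c] e [/eqP]; rewrite (negbTE (typeI_pt_neq0 _ _ _)).
have I_III s t : kerset (typeI_mx C s) <> kerset (typeIII_mx C t).
  move=> E; have := typeI_ptP s; rewrite E kerset_typeIII.
  by case: (triangle t) => -[a b] c [/eqP]; rewrite (negbTE (typeI_pt_neq0 _ _ _)).
have II_III i e1 e2 t : kerset (typeII_mx C i e1 e2) <> kerset (typeIII_mx C t).
  move=> E; have := typeII_ptP i e1 e2; rewrite E kerset_typeIII.
  have Z := @typeII_pt_eq0 i e1 e2.
  by elim/ord4_ind: t E; rewrite /triangle inordK // => _ [/Z E1 /Z E2 _];
    move: E2; rewrite -E1 !vertexE.
case: k k' => [[s|[[k e1] e2]]|t] [[s'|[[k' e1'] e2']]|t'] //= E.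
all: try by [case: (I_II _ _ _ _ E) | case: (I_III _ _ E) | case: (II_III _ _ _ _ E)].
all: try by [case: (I_II _ _ _ _ (esym E)) | case: (I_III _ _ (esym E))
  | case: (II_III _ _ _ _ (esym E))].
- have := typeI_ptP s; rewrite E kerset_typeI /typeI_pt !lcoord_edge_col !vertexE /=.
  have sgnM (c : C) e e' : sgn C e' * (c * sgn C e) = sgn C (e' == e) * c.
    by rewrite mulrCA mulrC; congr (_ * _);
      case: e e' => -[]; rewrite /sgn /= ?mulr1 ?mulrNN ?mul1r ?mulr1.
  rewrite !sgnM => -[/(sgn_lincomb_eq0 (p := 1) (q := 3) (r := 2)) E1].
  move=> /(sgn_lincomb_eq0 (p := 1) (q := 7) (r := 6)) E2.
  have [E13 E23] : s' (inord 0) = s (inord 0) /\ s' (inord 1) = s (inord 1).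
    by move: E1; do 2 case: eqP => ?.
  have [E14 E24] : s' (inord 2) = s (inord 2) /\ s' (inord 3) = s (inord 3).
    by move: E2; do 2 case: eqP => ?.
  rewrite E13 E14 !eqxx !mul1r => E3.
  have E34 : s' (inord 4) = s (inord 4).
    have := @sgn_lincomb_eq0 3 7 4 true (s' (inord 4) == s (inord 4)).
    by rewrite mul1r => /(_ E3); case: eqP.
  congr (inl (inl _)); apply/ffunP => i; rewrite -(inord_val i).
  by case: i => [[|[|[|[|[|?]]]]] ?].
- have := typeII_ptP k e1 e2; rewrite E kerset_typeII.
  have := edge_split_eidx k'.
  have kk' : k = k'.
    have := typeII_ptP k e1 e2; rewrite E kerset_typeII.
    have := edge_split_eidx k'; case: (edge_split k') => -[[a b] c] e Ek'.
    by case=> /typeII_pt_eq0 + _ _; rewrite Ek' => /val_inj.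
  move=> _; rewrite -{}kk' {E}; rewrite /typeII_pt.
  by elim/ord6_ind: k; rewrite /edge_split !inordK //= !lcoord_edge_col !vertexE /=;
    rewrite !mulr1 => -[_ /sgn_inj-> /sgn_inj->].
- congr inr; have := typeIII_ptP t; rewrite E kerset_typeIII /typeIII_pt.
  have nz : (1 : C) <> 0 by apply/eqP/oner_neq0.
  by elim/ord4_ind: t E; elim/ord4_ind: t'; rewrite /triangle !inordK //= => _;
    rewrite !lcoord_edge_col !vertexE //= => -[].
Qed.
End Distinct.

(** * Univariate polynomials: points of nonvanishing and the roots of a biquadratic *)

Lemma poly_neq0_horner (K : numDomainType) (p : {poly K}) :
  p != 0 -> exists t, p.[t] != 0.
Proof.
(* The natural numbers below [size p] are distinct in [K] and outnumber the possible roots of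
   [p]. *)
move=> np; pose rs : seq K := [seq i%:R | i <- iota 0 (size p)].
have /allPn[t _ nt] : ~~ all (root p) rs; last by exists t.
apply/negP => /(max_poly_roots np); rewrite size_map size_iota ltnn.
move=> no; apply: notF; apply: no.
by rewrite map_inj_uniq ?iota_uniq // => i j /eqP; rewrite eqr_nat => /eqP.
Qed.

Lemma poly_eq0_horner (K : numDomainType) (p : {poly K}) :
  (forall t, p.[t] = 0) -> p = 0.
Proof.
move=> p0; apply/eqP; apply: contraT => /poly_neq0_horner[t].
by rewrite p0 eqxx.
Qed.

(** The roots are the square roots of the two roots of [a m^2 + b m + d]. The factor [a] makes this
    a true quadratic, [d] keeps its roots away from zero, and the discriminant keeps them apart. *)
Lemma quartic_roots (K : numClosedFieldType) (a b d : K) :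
  a * d * (b ^+ 2 - 4 * a * d) != 0 ->
  exists s : seq K, [/\ uniq s, size s = 4%N &
    forall z, z \in s -> a * z ^+ 4 + b * z ^+ 2 + d = 0].
Proof.
rewrite !mulf_eq0 !negb_or => /andP[/andP[na nd]].
have := sqrtCK (b ^+ 2 - 4 * a * d); set e := sqrtC _ => e2.
rewrite -e2 expf_eq0 /= => ne.
have n2 : (2 : K) != 0 by rewrite pnatr_eq0.
have := sqrtCK ((- b + e) / (2 * a)); set u := sqrtC _ => u2.
have := sqrtCK ((- b - e) / (2 * a)); set w := sqrtC _ => w2.
have n0 (z : K) c : z ^+ 2 = (- b + c) / (2 * a) -> c ^+ 2 = e ^+ 2 -> z != 0.
  move=> z2 ce; apply: contraNneq nd => z0.
  have /eqP : 4 * a * d = 0.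
    rewrite (_ : 4 * a * d = b ^+ 2 - e ^+ 2); last by rewrite e2; ring.
    rewrite -ce; move/eqP: z2; rewrite z0 expr0n eq_sym mulf_eq0 invr_eq0.
    rewrite mulf_eq0 (negbTE n2) (negbTE na) !orbF addrC subr_eq0 => /eqP->.
    by rewrite subrr.
  by rewrite !mulf_eq0 pnatr_eq0 (negbTE na) /= => ->.
have rt (z : K) c : z ^+ 2 = (- b + c) / (2 * a) -> c ^+ 2 = e ^+ 2 ->
    a * z ^+ 4 + b * z ^+ 2 + d = 0.
  move=> z2 ce; rewrite (_ : z ^+ 4 = (z ^+ 2) ^+ 2); last by rewrite -exprM.
  transitivity ((c ^+ 2 - b ^+ 2 + 4 * a * d) / (4 * a)).
    by rewrite z2; field; rewrite ?na ?n2 ?pnatr_eq0.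
  by rewrite ce e2; field; rewrite ?na ?n2 ?pnatr_eq0.
have eN : (- e) ^+ 2 = e ^+ 2 by rewrite sqrrN.
have nu := n0 _ _ u2 erefl; have nw := n0 _ _ w2 eN.
have duw : u ^+ 2 != w ^+ 2.
  rewrite -subr_eq0 (_ : _ - _ = e / a); last by rewrite u2 w2; field; rewrite ?na ?n2 ?pnatr_eq0.
  by rewrite mulf_neq0 ?invr_eq0.
have nN (z : K) : z != 0 -> z != - z.
  by move=> nz; rewrite -subr_eq0 opprK -mulr2n mulrn_eq0.
have du : u != w /\ u != - w.
  by split; apply: contraNneq duw => ->; rewrite ?sqrrN.
have [d1 d2] := du.
exists [:: u; - u; w; - w]; split=> //=.
  rewrite !inE !negb_or nN // nN // d1 d2 eqr_oppLR d2 eqr_opp d1 //=.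
move=> z; rewrite !inE => /or4P[]/eqP->.
- exact: (rt _ e).
- by apply: (rt _ e) => //; rewrite sqrrN.
- exact: (rt _ (- e)).
- by apply: (rt _ (- e)) => //; rewrite sqrrN.
Qed.

Lemma rmorph_mmap n (R : nzRingType) (S T : nzRingType) (u : {rmorphism S -> T})
    (f : R -> S) (h : 'I_n -> S) p :
  u (mmap f h p) = mmap (u \o f) (u \o h) p.
Proof.
rewrite /mmap rmorph_sum; apply: eq_bigr => m _.
rewrite rmorphM /mmap1 rmorph_prod; congr (_ * _).
by apply: eq_bigr => i _; rewrite rmorphXn.
Qed.

(** * Restriction of a polynomial in six variables to a line *)

Section Restriction.
Variable (K : numFieldType).
Implicit Types (x v : 'cV[K]_6) (g h : {mpoly K[6]}).

Definition line x v (i : 'I_6) : {poly K} := (x i ord0)%:P + v i ord0 *: 'X.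

Definition restr x v g : {poly K} := mmap polyC (line x v) g.

Lemma line_horner x v i t : (line x v i).[t] = (x + t *: v) i ord0.
Proof. by rewrite /line !hornerE !mxE mulrC. Qed.

Lemma restr_horner x v g t : (restr x v g).[t] = g.@[fun i => (x + t *: v) i ord0].
Proof.
rewrite -/(horner_eval t _) rmorph_mmap /meval.
rewrite /mmap; apply: eq_bigr => m _ /=; rewrite /horner_eval hornerC; congr (_ * _).
by apply: mmap1_eq => i /=; rewrite line_horner.
Qed.

(** Both sides are additive in [g] and obey the Leibniz rule at [x], so constants and variables
    suffice. *)
Lemma restr_deriv0 x v g : (restr x v g)^`().[0]
  = \sum_(i < 6) (mderiv i g).@[fun k => x k ord0] * v i ord0.
Proof.
set D2 := fun g => \sum_(i < 6) (mderiv i g).@[fun k => x k ord0] * v i ord0.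
rewrite -/(D2 g).
have r0 h : (restr x v h).[0] = h.@[fun i => x i ord0].
  by rewrite restr_horner scale0r addr0.
have D2D h h' : D2 (h + h') = D2 h + D2 h'.
  rewrite /D2 -big_split; apply: eq_bigr => i _.
  by rewrite /= mderivD mevalD mulrDl.
have D2C c : D2 c%:MP = 0.
  by rewrite /D2 big1 // => i _; rewrite mderivC meval0 mul0r.
pose P h := (restr x v h)^`().[0] = D2 h.
have PM h h' : P h -> P h' -> P (h * h').
  rewrite /P /restr rmorphM derivM !hornerE => -> ->.
  rewrite -!/(restr _ _ _) !r0 /D2 mulr_suml mulr_sumr -big_split.
  apply: eq_bigr => i _ /=; rewrite mderivM mevalD !mevalM; ring.
have PC c : P c%:MP by rewrite /P /restr mmapC derivC horner0 D2C.
have P1 : P 1 by have := PC 1; rewrite mpolyC1.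
have PX i : P 'X_i.
  rewrite /P /restr mmapX mmap1U /line derivD derivC derivZ derivX !hornerE.
  rewrite /D2 (bigD1 i) //= big1 ?addr0 => [|j ji].
    rewrite mderivX mnmE eqxx mevalZ (_ : (U_(i) - U_(i))%MM = 0%MM).
      by rewrite mpolyX0 meval1 !mul1r.
    by apply/mnmP => l; rewrite !mnmE subnn.
  by rewrite mderivX mnmE eq_sym (negbTE ji) scale0r meval0 mul0r.
elim/mpolyind: g => [|c m p _ _ IH]; first by rewrite -[0]mpolyC0; apply: PC.
rewrite -/(P _) /P /restr rmorphD derivD hornerD D2D -!/(restr _ _ _) IH.
congr (_ + _); rewrite -/(P _) -mul_mpolyC; apply: (@PM) => //.
rewrite mpolyXE_id; apply: (big_ind P) => [//|h h'|i _]; first exact: PM.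
by elim: (m i) => [|n IHn]; rewrite ?expr0 // exprS; apply: (@PM).
Qed.

End Restriction.

(** * Divisibility by a biquadratic with polynomial coefficients *)

Section QuarticDivision.
Variable K : numClosedFieldType.

(* Pseudo-division; the remainder has degree at most three in the main variable
   but vanishes at the four distinct roots of almost every specialization. *)
Lemma quartic_dvd (a b d : {poly K}) (G : {poly {poly K}}) :
  a * d * (b ^+ 2 - 4 * a * d) != 0 ->
  (forall t s, a.[t] * s ^+ 4 + b.[t] * s ^+ 2 + d.[t] = 0 ->
    (map_poly (horner_eval t) G).[s] = 0) ->
  exists n Q, a ^+ n *: G = Q * (a *: 'X^4 + b *: 'X^2 + d%:P).
Proof.
set D := a * d * _ => nD G0; set q := a *: 'X^4 + _ + _.
have na : a != 0 by apply: contraNneq nD; rewrite /D => ->; rewrite !mul0r.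
have sq : (size (b *: 'X^2 + d%:P)%R < size (a *: 'X^4)%R)%N.
  rewrite size_scale // size_polyXn (leq_ltn_trans (size_polyD _ _)) // gtn_max.
  rewrite (leq_ltn_trans (size_scale_leq _ _)) ?size_polyXn //=.
  by rewrite (leq_ltn_trans (size_polyC_leq1 _)).
have qE : q = a *: 'X^4 + (b *: 'X^2 + d%:P) by rewrite addrA.
have size_q : size q = 5%N by rewrite qE size_polyDl // size_scale // size_polyXn.
have lead_q : lead_coef q = a.
  by rewrite qE lead_coefDl // lead_coefZ lead_coefXn mulr1.
have := Pdiv.Idomain.divp_eq G q; rewrite lead_q; set n := scalp G q.
set Q := _ %/ _; set r := _ %% _ => E.
have size_r : (size r < 5)%N.
  by rewrite -size_q Pdiv.Idomain.ltn_modp -size_poly_gt0 size_q.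
suff r0 : r = 0 by exists n, Q; rewrite E r0 addr0.
apply/polyP => i; rewrite coef0; apply/eqP.
(* The factor [D] disposes of the exceptional parameters; at every other [t] the specialized
   remainder has size less than 5 and four distinct roots. *)
have /eqP : r`_i * D = 0; last by rewrite mulf_eq0 (negbTE nD) orbF.
apply: poly_eq0_horner => t; rewrite hornerM.
have [->|nDt] := eqVneq D.[t] 0; first by rewrite mulr0.
have [|s [us ss rs]] := @quartic_roots _ a.[t] b.[t] d.[t].
  by move: nDt; rewrite /D !hornerE /= ; congr (_ != _); ring.
suff rt : map_poly (horner_eval t) r = 0.
  have := congr1 (fun p : {poly K} => p`_i) rt.
  by rewrite coef_map coef0 /= /horner_eval => ->; rewrite mul0r.
apply/eqP; apply: contraT => nr.
have : all (root (map_poly (horner_eval t) r)) s.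
  apply/allP => z /rs z0; apply/eqP.
  have := congr1 (fun p => (map_poly (horner_eval t) p).[z]) E.
  rewrite /= map_polyZ hornerZ G0 // mulr0 rmorphD rmorphM hornerD hornerM.
  have -> : (map_poly (horner_eval t) q).[z] = 0.
    rewrite -[RHS]z0 /q !rmorphD /= !map_polyZ !map_polyXn map_polyC /=.
    by rewrite !hornerE.
  by rewrite mulr0 add0r => ->.
move/(max_poly_roots nr)/(_ us); rewrite ss => /leq_trans/(_ (size_poly _ _)).
by move/leq_trans/(_ size_r).
Qed.
End QuarticDivision.

(** * The Cayley-Menger polynomial as a quadratic in [m34] *)

Section CMQuadratic.
Variable A : comPzRingType.

Definition cm1 (m12 m13 m14 m23 m24 : A) : A :=
  8 * m14 * m24 + 2 * (m14 + m24 - m12) * (m14 - m13 + m24 - m23)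
  - 4 * m14 * (m24 - m23) - 4 * m24 * (m14 - m13) - 2 * (m14 + m24 - m12) ^+ 2.

Definition cm0 (m12 m13 m14 m23 m24 : A) : A := cm m12 m13 m14 m23 m24 0.

Lemma cm_quadratic (m12 m13 m14 m23 m24 m34 : A) :
  cm m12 m13 m14 m23 m24 m34 =
  - 2 * m12 * m34 ^+ 2 + cm1 m12 m13 m14 m23 m24 * m34 + cm0 m12 m13 m14 m23 m24.
Proof. by rewrite /cm1 /cm0 /cm; ring. Qed.

(** This is [a d (b^2 - 4 a d)] for the quadratic in [m34]; where it is nonzero, four distinct
    values of [l34] complete the other five lengths to a point of the hypersurface. *)
Definition cm_disc (m12 m13 m14 m23 m24 : A) : A :=
  - 2 * m12 * cm0 m12 m13 m14 m23 m24 * (cm1 m12 m13 m14 m23 m24 ^+ 2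
    - 4 * (- 2 * m12) * cm0 m12 m13 m14 m23 m24).
End CMQuadratic.

Section Morphism.
Variables (A B : comPzRingType) (f : {rmorphism A -> B}).

Lemma dcm_morph a b c d e g :
  f (dcm a b c d e g) = dcm (f a) (f b) (f c) (f d) (f e) (f g).
Proof. by rewrite /dcm; ring. Qed.

Lemma cm1_morph a b c d e :
  f (cm1 a b c d e) = cm1 (f a) (f b) (f c) (f d) (f e).
Proof. by rewrite /cm1; ring. Qed.

Lemma cm0_morph a b c d e :
  f (cm0 a b c d e) = cm0 (f a) (f b) (f c) (f d) (f e).
Proof. by rewrite /cm0 cm_morph rmorph0. Qed.

Lemma cm_disc_morph a b c d e :
  f (cm_disc a b c d e) = cm_disc (f a) (f b) (f c) (f d) (f e).
Proof. by rewrite /cm_disc -cm1_morph -cm0_morph; ring. Qed.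
End Morphism.

Lemma deriv_cm (K : comNzRingType) (m12 m13 m14 m23 m24 m34 : {poly K}) :
  (cm m12 m13 m14 m23 m24 m34)^`() =
    m12^`() * dcm m12 m13 m14 m23 m24 m34
  + m13^`() * dcm m13 m12 m14 m23 m34 m24
  + m14^`() * dcm m14 m13 m12 m34 m24 m23
  + m23^`() * dcm m23 m12 m24 m13 m34 m14
  + m24^`() * dcm m24 m23 m12 m34 m14 m13
  + m34^`() * dcm m34 m13 m23 m14 m24 m12.
Proof.
have dn n : (n%:R : {poly K})^`() = 0 by rewrite -polyC_natr derivC.
by rewrite /cm /dcm !expr2 !(dn, derivD, derivN, derivM); ring.
Qed.

(** The ring is arbitrary so that [y] can be a point, a line with polynomial coordinates, or the
    tuple of variables of [{mpoly K[6]}]. *)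
Definition cm_edges (A : comPzRingType) (y : 'I_6 -> A) : A :=
  cm (y (eidx v1 v2) ^+ 2) (y (eidx v1 v3) ^+ 2) (y (eidx v1 v4) ^+ 2)
     (y (eidx v2 v3) ^+ 2) (y (eidx v2 v4) ^+ 2) (y (eidx v3 v4) ^+ 2).

Lemma cm_edges_morph (A B : comPzRingType) (f : {rmorphism A -> B}) y :
  f (cm_edges y) = cm_edges (f \o y).
Proof. by rewrite /cm_edges cm_morph !rmorphXn. Qed.

(** * The Zariski tangent space of the hypersurface at critical points *)

Section Tangent.
Variable K : numClosedFieldType.
Implicit Types (x v : 'cV[K]_6) (g : {mpoly K[6]}).

Lemma L24E x : L24 x <-> cm_edges (fun i => x i ord0) = 0.
Proof. by rewrite /L24 det_gram4. Qed.

Lemma deriv_cm_line x v : let l := lcoord x in let w := lcoord v in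
  let m12 := l v1 v2 ^+ 2 in let m13 := l v1 v3 ^+ 2 in
  let m14 := l v1 v4 ^+ 2 in let m23 := l v2 v3 ^+ 2 in
  let m24 := l v2 v4 ^+ 2 in let m34 := l v3 v4 ^+ 2 in
  (cm_edges (line x v))^`().[0] = 2 * (
    w v1 v2 * (l v1 v2 * dcm m12 m13 m14 m23 m24 m34)
  + w v1 v3 * (l v1 v3 * dcm m13 m12 m14 m23 m34 m24)
  + w v1 v4 * (l v1 v4 * dcm m14 m13 m12 m34 m24 m23)
  + w v2 v3 * (l v2 v3 * dcm m23 m12 m24 m13 m34 m14)
  + w v2 v4 * (l v2 v4 * dcm m24 m23 m12 m34 m14 m13)
  + w v3 v4 * (l v3 v4 * dcm m34 m13 m23 m14 m24 m12)).
Proof.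
rewrite /= /cm_edges deriv_cm.
have dcm_horner (a b c d e f : {poly K}) :
    (dcm a b c d e f).[0] = dcm a.[0] b.[0] c.[0] d.[0] e.[0] f.[0].
  by rewrite -!/(horner_eval 0 _) dcm_morph.
have dl i : (line x v i ^+ 2)^`().[0] = 2 * v i ord0 * x i ord0.
  rewrite expr2 derivM hornerD !hornerM /line derivD derivC derivZ derivX.
  by rewrite !hornerE; ring.
have l0 i : (line x v i ^+ 2).[0] = x i ord0 ^+ 2.
  by rewrite horner_exp line_horner scale0r addr0.
by rewrite !hornerD !hornerM !dl !dcm_horner !l0 /lcoord; ring.
Qed.

(** At parameter 0 both the value and the first derivative vanish, so 0 is a double root. *)
Lemma critical_line x v : critical x ->
  exists q, cm_edges (line x v) = q * 'X^2.
Proof.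
case=> c0 [D12 D13 D14] [D23 D24 D34]; set p := cm_edges _.
have p0 : p.[0] = 0.
  rewrite -/(horner_eval 0 _) cm_edges_morph -[RHS]c0 /cm_edges /=.
  by rewrite /horner_eval !line_horner scale0r addr0.
have p1 : p^`().[0] = 0.
  by rewrite deriv_cm_line /= D12 D13 D14 D23 D24 D34 !mulr0 !addr0 mulr0.
have /factor_theorem[q pE] : root p 0 by apply/eqP.
move: p1; rewrite pE derivM derivXsubC hornerD !hornerM hornerXsubC subrr mulr0
  add0r hornerC mulr1 => q0.
have /factor_theorem[q' ->] : root q 0 by apply/eqP.
by exists q'; rewrite subr0 -mulrA -expr2.
Qed.

(** * An edge [k1], later taken of nonzero length, and its opposite edge [k6], in the roles of 12
    and 34 *)

Section Edge.
Variables k1 k2 k3 k4 k5 k6 : 'I_6.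
Hypothesis uniq_k : uniq [:: k1; k2; k3; k4; k5; k6].
Hypothesis cm_edgesE : forall (A : comPzRingType) (y : 'I_6 -> A), cm_edges y =
  cm (y k1 ^+ 2) (y k2 ^+ 2) (y k3 ^+ 2) (y k4 ^+ 2) (y k5 ^+ 2) (y k6 ^+ 2).

Let disc (A : comPzRingType) (y : 'I_6 -> A) : A :=
  cm_disc (y k1 ^+ 2) (y k2 ^+ 2) (y k3 ^+ 2) (y k4 ^+ 2) (y k5 ^+ 2).

Let discM (A B : comPzRingType) (f : {rmorphism A -> B}) y :
  f (disc y) = disc (f \o y).
Proof. by rewrite /disc cm_disc_morph !rmorphXn. Qed.

Let disc_horner x v t : (disc (line x v)).[t] = disc (fun i => (x + t *: v) i ord0).
Proof.
rewrite -/(horner_eval t _) discM /disc /=.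
by rewrite /horner_eval !line_horner.
Qed.

(** The coordinate [k6] is freed while the others follow the line. Pseudo-division there, followed
    by returning [k6] to the line, makes [a^n] times the restriction of [g] a multiple of
    [cm_edges l], hence of ['X^2]. *)
Lemma tangent_generic x v g : critical x -> x k1 ord0 != 0 ->
  disc (fun i => (x + v) i ord0) != 0 -> vanishing_ideal (@L24 K) g ->
  \sum_(i < 6) (mderiv i g).@[fun k => x k ord0] * v i ord0 = 0.
Proof.
move=> cx nx nd Ig.
pose l := line x v.
pose a := - 2 * l k1 ^+ 2.
pose b := cm1 (l k1 ^+ 2) (l k2 ^+ 2) (l k3 ^+ 2) (l k4 ^+ 2) (l k5 ^+ 2).
pose d := cm0 (l k1 ^+ 2) (l k2 ^+ 2) (l k3 ^+ 2) (l k4 ^+ 2) (l k5 ^+ 2).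
pose h i : {poly {poly K}} := if i == k6 then 'X else (l i)%:P.
pose G := mmap (polyC \o polyC) h g.
have n6 k : k \in [:: k1; k2; k3; k4; k5] -> (k == k6) = false.
  move=> kin; apply: contraTF uniq_k => /eqP Ek.
  rewrite -[[:: k1, k2 & _]]/([:: k1; k2; k3; k4; k5] ++ [:: k6]) cat_uniq.
  by rewrite /= -Ek kin !andbF.
have nD : a * d * (b ^+ 2 - 4 * a * d) != 0.
  apply: contraNneq nd => D0.
  (* At parameter 1 the line passes through [x + v], where [disc] is nonzero. *)
  have := disc_horner x v 1; rewrite scale1r => <-.
  by rewrite (_ : disc _ = a * d * (b ^+ 2 - 4 * a * d)) ?D0 ?horner0.
have G0 t s : a.[t] * s ^+ 4 + b.[t] * s ^+ 2 + d.[t] = 0 ->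
    (map_poly (horner_eval t) G).[s] = 0.
  move=> E; pose z : 'cV[K]_6 := \col_i if i == k6 then s else (x + t *: v) i ord0.
  have zE i : z i ord0 = if i == k6 then s else (x + t *: v) i ord0 by rewrite mxE.
  have : L24 z.
    apply/L24E; rewrite cm_edgesE !zE eqxx.
    rewrite !n6 ?inE ?eqxx ?orbT //.
    rewrite cm_quadratic -[RHS]E -!line_horner -exprM -/l.
    rewrite -!/(horner_eval t _) /b /d cm1_morph cm0_morph !rmorphXn.
    by rewrite /a rmorphM rmorphXn rmorphN rmorph_nat.
  move/Ig => <-; rewrite -/(horner_eval s _) rmorph_mmap /= rmorph_mmap /meval.
  rewrite /mmap; apply: eq_bigr => m _; congr (_ * _).
    by rewrite /= map_polyC /= /horner_eval !hornerC.
  apply: mmap1_eq => i /=; rewrite zE /h.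
  case: eqP => _; first by rewrite map_polyX /horner_eval hornerX.
  by rewrite map_polyC /= /horner_eval hornerC line_horner.
have [n [Q E]] := quartic_dvd nD G0.
have EG : G.[l k6] = restr x v g.
  rewrite -/(horner_eval _ _) rmorph_mmap /restr /mmap; apply: eq_bigr => m _ /=.
  rewrite /horner_eval hornerC; congr (_ * _); apply: mmap1_eq => i /=.
  by rewrite /h; case: eqP => [->|_]; rewrite ?hornerX ?hornerC.
have {}E := congr1 (fun p : {poly {poly K}} => p.[l k6]) E.
move: E; rewrite /= hornerZ EG hornerM.
have -> : (a *: 'X^4 + b *: 'X^2 + d%:P).[l k6] = cm_edges l.
  rewrite cm_edgesE cm_quadratic !hornerD !hornerZ !hornerXn hornerC -exprM.
  by rewrite /a /b /d.
have [q ->] := critical_line v cx => E.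
have dv : 'X^2 %| restr x v g.
  (* The power of [a] can be cancelled: [a] takes the value [-2 x_k1^2], which is nonzero, at 0, so
     it is coprime to ['X]. *)
  rewrite -(@Gauss_dvdpr _ _ (a ^+ n)); last first.
    rewrite coprimep_expl // coprimep_expr // coprimep_sym.
    rewrite -[X in coprimep _ X]subr0 -polyC0 coprimep_XsubC /root /a.
    rewrite hornerM horner_exp line_horner scale0r addr0 mulf_neq0 ?expf_neq0 //.
    by rewrite -polyC_natr -polyCN hornerC oppr_eq0 pnatr_eq0.
  by rewrite E mulrA dvdp_mulIr.
rewrite -restr_deriv0; have /dvdpP[r ->] := dv.
by rewrite derivM derivXn hornerD !hornerM hornerMn !hornerXn !expr0n /=
  mul0rn !mulr0 addr0.
Qed.

(** The differential of [g] is linear in the direction and vanishes on generic directions. Any [v]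
    is, up to a nonzero scalar, the difference of the two generic directions [w0 + u v] and [w0]. *)
Lemma tangent_edge x v g : critical x -> x k1 ord0 != 0 ->
  vanishing_ideal (@L24 K) g ->
  \sum_(i < 6) (mderiv i g).@[fun k => x k ord0] * v i ord0 = 0.
Proof.
move=> cx nx Ig.
(* For the lengths 1, 1, 2, 1, 2 the quadratic is [-2 m^2 + 18 m - 18], which has two distinct
   nonzero roots. *)
pose y0 i : K := if i \in [:: k3; k5] then 2 else 1.
have ny0 : disc y0 != 0.
  move: uniq_k; rewrite /= !inE !negb_or /disc /y0 !inE.
  case/and5P=> /and5P[_ n13 _ n15 _] /and4P[n23 _ n25 _] /and3P[n34 _ _].
  move=> /andP[n45 _] _; rewrite !eqxx orbT (negbTE n13) (negbTE n15) (negbTE n23).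
  rewrite (negbTE n25) (negbTE n45) [k4 == k3]eq_sym (negbTE n34) /=.
  rewrite (_ : cm_disc _ _ _ _ _ = 36 * 180 :> K).
    by rewrite mulf_neq0 ?pnatr_eq0.
  by rewrite /cm_disc /cm1 /cm0 /cm; ring.
pose dg (w : 'cV[K]_6) : K := \sum_(i < 6) (mderiv i g).@[fun k => x k ord0] * w i ord0.
pose w0 : 'cV[K]_6 := (\col_i y0 i) - x.
have xw0 : (x + w0) = \col_i y0 i by rewrite addrC subrK.
have gen w : disc (fun i => (x + w) i ord0) != 0 -> dg w = 0.
  by move=> nd; apply: tangent_generic.
have d0 : disc (fun i => (x + w0) i ord0) != 0.
  by rewrite xw0 /disc !mxE.
have [u nu du] : exists2 u, u != 0 & disc (fun i => (x + (w0 + u *: v)) i ord0) != 0.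
  pose p := disc (line (x + w0) v).
  (* The factor ['X] ensures that the parameter [u] is nonzero. *)
  have np : 'X * p != 0.
    rewrite mulf_neq0 ?polyX_eq0 //; apply: contraNneq d0 => p0.
    have := disc_horner (x + w0) v 0; rewrite scale0r addr0 => <-.
    by rewrite -/p p0 horner0.
  have [u] := poly_neq0_horner np.
  rewrite hornerM hornerX mulf_eq0 negb_or => /andP[nu np'].
  by exists u => //; rewrite addrA -disc_horner.
have := gen _ du; have -> : dg (w0 + u *: v) = dg w0 + u * dg v.
  rewrite /dg mulr_sumr -big_split; apply: eq_bigr => i _ /=.
  by rewrite !mxE; ring.
by rewrite gen // add0r => /eqP; rewrite mulf_eq0 (negbTE nu) => /eqP.
Qed.

End Edge.


Lemma eidx_vertexE :
  ((eidx v1 v2 = inord 0) * (eidx v1 v3 = inord 1) * (eidx v1 v4 = inord 2)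
  * (eidx v2 v3 = inord 3) * (eidx v2 v4 = inord 4) * (eidx v3 v4 = inord 5))%type.
Proof. by rewrite /eidx !vertexE. Qed.

Lemma tangent_neq0 x v g : critical x -> x != 0 -> vanishing_ideal (@L24 K) g ->
  \sum_(i < 6) (mderiv i g).@[fun k => x k ord0] * v i ord0 = 0.
Proof.
move=> cx nx Ig.
have [k nk] : exists k, x k ord0 != 0.
  by have /cV0Pn := nx.
have E := eidx_vertexE.
elim/ord6_ind: k nk => nk.
- apply: (@tangent_edge (inord 0) (inord 1) (inord 2) (inord 3) (inord 4)
    (inord 5)) => //.
    by rewrite /= !inE -!val_eqE /= !inordK.
  by move=> A y; rewrite /cm_edges !E /cm; ring.
- apply: (@tangent_edge (inord 1) (inord 0) (inord 2) (inord 3) (inord 5)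
    (inord 4)) => //.
    by rewrite /= !inE -!val_eqE /= !inordK.
  by move=> A y; rewrite /cm_edges !E /cm; ring.
- apply: (@tangent_edge (inord 2) (inord 1) (inord 0) (inord 5) (inord 4)
    (inord 3)) => //.
    by rewrite /= !inE -!val_eqE /= !inordK.
  by move=> A y; rewrite /cm_edges !E /cm; ring.
- apply: (@tangent_edge (inord 3) (inord 0) (inord 4) (inord 1) (inord 5)
    (inord 2)) => //.
    by rewrite /= !inE -!val_eqE /= !inordK.
  by move=> A y; rewrite /cm_edges !E /cm; ring.
- apply: (@tangent_edge (inord 4) (inord 3) (inord 0) (inord 5) (inord 2)
    (inord 1)) => //.
    by rewrite /= !inE -!val_eqE /= !inordK.
  by move=> A y; rewrite /cm_edges !E /cm; ring.
- apply: (@tangent_edge (inord 5) (inord 1) (inord 3) (inord 2) (inord 4)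
    (inord 0)) => //.
    by rewrite /= !inE -!val_eqE /= !inordK.
  by move=> A y; rewrite /cm_edges !E /cm; ring.
Qed.

(* The origin is a limit of singular points, along any line of the cone. *)
Lemma critical_tangent x v : critical x -> zariski_tangent (@L24 K) x v.
Proof.
move=> cx g Ig; have [->|nx] := eqVneq x 0; last exact: tangent_neq0.
(* All edges of the triangle 234 vanish on the multiples of [y], so these lie in a type III
   subspace. *)
pose y : 'cV[K]_6 := delta_mx (eidx v1 v2) ord0.
have yE a b : lcoord y a b = (eidx_nat a b == 0%N)%:R.
  by rewrite /lcoord mxE andbT -val_eqE /= !eidxE !vertexE.
pose q := \sum_(i < 6) restr 0 y (mderiv i g) * (v i ord0)%:P.
have qE t : q.[t] = \sum_(i < 6) (mderiv i g).@[fun k => (t *: y) k ord0] * v i ord0.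
  rewrite horner_sum; apply: eq_bigr => i _.
  by rewrite hornerM hornerC restr_horner add0r.
suff q0 : q = 0 by have := qE 0; rewrite q0 horner0 scale0r.
apply/eqP; apply: contraT => nq.
have [|t] := @poly_neq0_horner _ ('X * q); first by rewrite mulf_neq0 ?polyX_eq0.
rewrite hornerM hornerX mulf_eq0 negb_or => /andP[nt].
rewrite qE tangent_neq0 ?eqxx //.
  apply: (@sing_mx_critical _ (inr ord0)) => /=.
  apply/kerset_typeIII; rewrite /triangle /=.
  have tyE a b : lcoord (t *: y) a b = t * lcoord y a b by rewrite /lcoord mxE.
  by rewrite !tyE !yE !vertexE /= mulr0.
rewrite scaler_eq0 negb_or nt; apply/cV0Pn; exists (eidx v1 v2).
by rewrite -/(lcoord y v1 v2) yE !vertexE oner_neq0.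
Qed.

(** For the forward direction, the tangent condition is tested on the defining equation in the six
    coordinate directions; the converse is [critical_tangent]. *)
Lemma sing_critical x : sing_L24 x <-> critical x.
Proof.
split=> [[Lx Tx]|cx]; last first.
  by split=> [|v]; [apply/L24E; case: cx | exact: critical_tangent].
pose f : {mpoly K[6]} := cm_edges (fun i => 'X_i).
have If : vanishing_ideal (@L24 K) f.
  move=> y /L24E <-; rewrite cm_edges_morph /cm_edges /=.
  by rewrite !mevalXU.
have df v : (cm_edges (line x v))^`().[0] = 0.
  have <- : restr x v f = cm_edges (line x v).
    by rewrite /restr cm_edges_morph /cm_edges /= !mmapX !mmap1U.
  by rewrite restr_deriv0; apply: Tx.
have n2 : (2 : K) != 0 by rewrite pnatr_eq0.
have D n := df (edge_col (fun j => (j == n)%:R)).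
have {}D n := etrans (esym (deriv_cm_line x (edge_col (fun j => (j == n)%:R)))) (D n).
have mk (z : K) : 2 * z = 0 -> z = 0.
  by move=> /eqP; rewrite mulf_eq0 (negbTE n2) => /eqP.
have := D 5; have := D 4; have := D 3; have := D 2; have := D 1%N; have := D 0%N.
rewrite /= !lcoord_edge_col !vertexE /= !(mul0r, mul1r, addr0, add0r).
by move=> /mk ? /mk ? /mk ? /mk ? /mk ? /mk ?; split=> //; apply/L24E.
Qed.

End Tangent.

Theorem theorem5p17 (R : realType) :
  #|sing_index| = 60%N /\
  (* each of the listed subspaces is 3-dimensional (3 independent equations) *)
  (forall k : sing_index, \rank (sing_mx R[i] k) = 3%N) /\
  (* the 60 subspaces are pairwise distinct *)
  (forall k k' : sing_index,
     kerset (sing_mx R[i] k) = kerset (sing_mx R[i] k') -> k = k') /\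
  (* sing(L_{2,4}) is their union *)
  (forall x : 'cV[R[i]]_6,
     sing_L24 x <-> exists k : sing_index, kerset (sing_mx R[i] k) x) /\
  (* the union of the 32 Type I subspaces is L_{1,4} *)
  (forall x : 'cV[R[i]]_6,
     L14 x <-> exists s : {ffun 'I_5 -> bool}, kerset (typeI_mx R[i] s) x).
Proof.
have n2 : (2 : R[i]) != 0 by rewrite pnatr_eq0.
split; first by rewrite !card_sum !card_prod card_ffun !card_ord !card_bool.
split; first exact: sing_mx_rank.
split; first exact: kerset_sing_inj.
split; last exact: L14_typeI.
move=> x; rewrite sing_critical; split; first exact: critical_sing.
by case=> k; apply: sing_mx_critical.
Qed.
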